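(* Let $p \geq 5$ be a prime number. For every integer $n\ge 0$ let $T_n$ denote the $n$th central trinomial coefficient. Then for every integer $j$ with $0 \leq j \leq p-1$, we have $p \mid T_j$ if and only if $p \mid T_{p-1-j}$.
   Context: For an integer $n \geq 0$, the $n$th central trinomial coefficient $T_n$ is the coefficient of $x^n$ in the expansion of $(1+x+x^2)^n$ (equivalently, the largest coefficient of this polynomial). *)

(* Defs.v *)
From mathcomp Require Import all_boot all_order all_algebra.

Set Implicit Arguments.
Unset Strict Implicit.
Unset Printing Implicit Defensive.

Import GRing.Theory.
Local Open Scope ring_scope.

Definition central_trinomial (n : nat) : int :=
  ((1 + 'X + 'X^2 : {poly int}) ^+ n)`_n.

(* Main.v *)
Require Import Defs.
From mathcomp Require Import all_boot all_order all_algebra.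
From mathcomp Require Import ring zify.

Import GRing.Theory.
Local Open Scope ring_scope.

(** The central trinomial coefficients satisfy
    [(n+2) T_(n+2) = (2n+3) T_(n+1) + 3(n+1) T_n].  Modulo [p], this recurrence
    is invariant under replacing [T_n] by [(-3)^n T_(p-1-n)]; comparing initial
    values gives [(-3)^n T_(p-1-n) = T_(p-1) T_n] in [F_p] for [n < p].  Taking
    [n = p-1] yields [T_(p-1)^2 = (-3)^(p-1)], so [T_(p-1)] is invertible when
    [p <> 3]. *)

Local Notation P := (1 + 'X + 'X^2 : {poly int}).

Lemma coef_trinomialM (q : {poly int}) k :
  (P * q)`_k.+2 = q`_k.+2 + q`_k.+1 + q`_k.
Proof. by rewrite !mulrDl mul1r !coefD coefXM coefXnM /= subn2. Qed.

Lemma coef_trinomialM1 (q : {poly int}) : (P * q)`_1 = q`_1 + q`_0.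
Proof. by rewrite !mulrDl mul1r !coefD coefXM coefXnM /= addr0. Qed.

(** Multiplying the derivative by [P] restores the full power [P ^+ n], so comparing coefficients
    gives linear relations within a single power. *)
Lemma deriv_trinomialX n :
  P * (P ^+ n)^`() = (1 + 'X *+ 2) * P ^+ n *+ n.
Proof.
rewrite deriv_exp !derivD derivC derivX derivXn /= add0r expr1.
case: n => [|n]; first by rewrite !mulr0n mulr0.
by rewrite /= mulrnAr mulrA (mulrC P) -mulrA (exprS P).
Qed.

(* Coefficient of [X^(k+2)] in [P * (P^n)' = n (1 + 2X) P^n]. *)
Lemma coef_trinomialX_rel n k :
  (P ^+ n)`_k.+3 *+ k.+3 + (P ^+ n)`_k.+2 *+ k.+2 + (P ^+ n)`_k.+1 *+ k.+1
  = ((P ^+ n)`_k.+2 + (P ^+ n)`_k.+1 *+ 2) *+ n.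
Proof.
have /(congr1 (fun q : {poly int} => q`_k.+2)) := deriv_trinomialX n.
by rewrite coef_trinomialM !coef_deriv coefMn mulrDl mul1r mulrnAl coefD coefMn
  coefXM.
Qed.

Lemma coef_trinomialX_rel1 n :
  (P ^+ n)`_2 *+ 2 + (P ^+ n)`_1 = ((P ^+ n)`_1 + (P ^+ n)`_0 *+ 2) *+ n.
Proof.
have /(congr1 (fun q : {poly int} => q`_1)) := deriv_trinomialX n.
by rewrite coef_trinomialM1 !coef_deriv coefMn mulrDl mul1r mulrnAl coefD coefMn
  coefXM.
Qed.

(** At the centre the derivative relation loses its middle coefficient, leaving [n.+2] times each
    neighbour. *)
Lemma coef_trinomialX_sym n : (P ^+ n.+1)`_n.+2 = (P ^+ n.+1)`_n.
Proof.
have nz : n.+2%:Z != 0 by [].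
apply: (mulfI nz); case: n {nz} => [|n].
  by have := coef_trinomialX_rel1 1; lia.
by have := coef_trinomialX_rel n.+2 n; lia.
Qed.

Lemma central_trinomial0 : central_trinomial 0 = 1.
Proof. by rewrite /central_trinomial expr0 coef1. Qed.

Lemma central_trinomial1 : central_trinomial 1 = 1.
Proof. by rewrite /central_trinomial expr1 !coefD coef1 coefX coefXn. Qed.

Lemma central_trinomial_rec n :
  n.+2%:Z * central_trinomial n.+2 =
  (2 * n + 3)%:Z * central_trinomial n.+1 + (3 * n.+1)%:Z * central_trinomial n.
Proof.
rewrite {1}/central_trinomial exprS coef_trinomialM coef_trinomialX_sym.
case: n => [|n].
  by rewrite central_trinomial0 central_trinomial1 expr1 !coefD !coefC !coefX
    !coefXn.
rewrite -coef_trinomialX_sym /central_trinomial.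
have symn := coef_trinomialX_sym n.
have reln := coef_trinomialX_rel n.+1 n.
have e1 := coef_trinomialM (P ^+ n.+1) n.+1.
have e0 := coef_trinomialM (P ^+ n.+1) n.
rewrite -!exprS in e0 e1.
(* Only the coefficients of [P ^+ n.+1] at [n.+1], [n.+2], [n.+3] remain, and [reln] ties them
   together. *)
rewrite e1 e0 -symn.
move: reln; move: (P ^+ n.+1)`_n.+1 (P ^+ n.+1)`_n.+2 (P ^+ n.+1)`_n.+3.
by move=> x y z; nia.
Qed.

Lemma dvdz_central_trinomial p n : prime p ->
  (p%:Z %| central_trinomial n)%Z = ((central_trinomial n)%:~R == 0 :> 'F_p).
Proof. by move=> hp; rewrite -(dvdz_pcharf (pchar_Fp hp)). Qed.

(** The index enters as the ring element [n%:R], so that in ['F_p] it can be replaced by a negative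
    residue. *)
Lemma central_trinomial_ring_rec (R : pzRingType) n :
  (n%:R + 2) * (central_trinomial n.+2)%:~R =
  (2 * n%:R + 3) * (central_trinomial n.+1)%:~R
  + 3 * (n%:R + 1) * (central_trinomial n)%:~R :> R.
Proof.
have /(congr1 (fun z : int => z%:~R : R)) := central_trinomial_rec n.
rewrite rmorphD !rmorphM /= -!pmulrn => e.
by rewrite -natrD addn2 e !natrM natrD natrM natr1.
Qed.

Lemma central_trinomial_reflection p n : prime p -> (n < p)%N ->
  (-3) ^+ n * (central_trinomial (p.-1 - n))%:~R
  = (central_trinomial p.-1)%:~R * (central_trinomial n)%:~R :> 'F_p.
Proof.
move=> hp; pose t n : 'F_p := (central_trinomial n)%:~R.
rewrite -/(t _) -/(t n) -/(t p.-1).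
have p0 : p%:R = 0 :> 'F_p by rewrite pchar_Fp_0.
have trec k : (k%:R + 2) * t k.+2
    = (2 * k%:R + 3) * t k.+1 + 3 * (k%:R + 1) * t k.
  exact: central_trinomial_ring_rec.
have t0 : t 0 = 1 by rewrite /t central_trinomial0.
have t1 : t 1 = 1 by rewrite /t central_trinomial1.
have [m] := ubnP n; elim: m n => // m IH [|[|n]] lt_nm lt_np.
- by rewrite subn0 t0 mul1r mulr1.
(* At [k = p - 2] the leading coefficient of the recurrence vanishes, which links the top two
   values. *)
- have [k Dp] : exists k, p = (k + 2)%N by exists p.-2; lia.
  have kE : k%:R = - 2 :> 'F_p.
    by apply/eqP; rewrite -addr_eq0 -natrD -Dp p0.
  have := trec k; rewrite kE t1.
  have -> : p.-1 = k.+1 by lia.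
  rewrite subn1 /= => e; apply/eqP; rewrite -subr_eq0; apply/eqP.
  by rewrite -[RHS](subrr ((- 2 + 2) * t k.+2)) [X in _ = X - _]e; ring.
(* This [k] is the reflection of [n.+2]; the recurrence at [k] thus runs through the three reflected
   indices. *)
have [k Dp] : exists k, p = (k + (n + 3))%N by exists (p - (n + 3))%N; lia.
have kE : k%:R = - (n%:R + 3) :> 'F_p.
  by apply/eqP; rewrite -addr_eq0 -natrD -natrD -Dp p0.
have nz : n%:R + 2 != 0 :> 'F_p.
  by rewrite -natrD -(dvdn_pcharf (pchar_Fp hp)) gtnNdvd // ?addn2.
have IH0 := IH n ltac:(lia) ltac:(lia).
have IH1 := IH n.+1 ltac:(lia) ltac:(lia).
have := trec k; rewrite kE.
move: IH0 IH1.
have -> : (p.-1 - n = k.+2)%N by lia.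
have -> : (p.-1 - n.+1 = k.+1)%N by lia.
have -> : (p.-1 - n.+2 = k)%N by lia.
move=> IH0 IH1 e; apply: (mulfI nz).
rewrite [RHS]mulrCA trec mulrDr.
rewrite [X in _ = X + _]mulrCA [X in _ = _ + X]mulrCA -IH0 -IH1 !exprS.
set c := (-3) ^+ n.
apply/eqP; rewrite -subr_eq0; apply/eqP.
(* The difference of the two sides is [3 * c] times the recurrence [e]. *)
rewrite -[RHS](mulr0 (3 * c)).
rewrite -[X in _ = _ * X](subrr ((- (n%:R + 3) + 2) * t k.+2)).
by rewrite [X in _ = _ * (_ - X)]e; ring.
Qed.

Theorem mainTheorem1 (p : nat) (hp : prime p) (hp5 : (5 <= p)%N)
    (j : nat) (hj : (j <= p - 1)%N) :
  (p%:Z %| central_trinomial j)%Z <-> (p%:Z %| central_trinomial (p - 1 - j))%Z.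
Proof.
have n3 : -3 != 0 :> 'F_p.
  by rewrite oppr_eq0 -(dvdn_pcharf (pchar_Fp hp)) gtnNdvd //; lia.
have refl := @central_trinomial_reflection p _ hp.
have tp : (central_trinomial p.-1)%:~R != 0 :> 'F_p.
  have := refl p.-1 ltac:(lia); rewrite subnn central_trinomial0 mulr1 => e.
  by have := expf_neq0 p.-1 n3; rewrite e mulf_eq0 orbb.
have e := refl j ltac:(lia).
rewrite !dvdz_central_trinomial // subn1.
(* The nonzero factor [(-3) ^+ j] is inserted on the right so that the reflection identity
   applies. *)
rewrite -[X in _ <-> is_true X]orFb -(negbTE (expf_neq0 j n3)) -mulf_eq0 e.
by rewrite mulf_eq0 (negbTE tp).
Qed.
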